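(* For every $n\in\mathbb{N}$ (so $n\geq 1$), there exists a graph $G$ such that $$C_s(G)=n+2.$$
   Context: All graphs are finite, simple and undirected. $N(v)$ denotes the open neighborhood of a vertex $v$, and for $S\subseteq V(G)$ we write $\overline{S}=V(G)\setminus S$. A set $S\subseteq V(G)$ is a dominating set if every vertex of $\overline{S}$ is adjacent to a vertex of $S$. A dominating set $S$ is a super dominating set if for every $u\in\overline{S}$ there exists $v\in S$ with $N(v)\cap\overline{S}=\{u\}$. A super coalition partition of $G$ is a partition $\{A_1,\dots,A_k\}$ of $V(G)$ (into nonempty parts) such that (i) no part $A_i$ is a super dominating set of $G$, and (ii) for every part $A_i$ there is at least one distinct part $A_j$ ($j\neq i$) such that $A_i\cup A_j$ is a super dominating set of $G$. The super coalition number $C_s(G)$ is the maximum cardinality of a super coalition partition of $G$, with $C_s(G)=0$ if $G$ admits no super coalition partition. *)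

(* Defs.v *)
From mathcomp Require Import all_boot.

Set Implicit Arguments.
Unset Strict Implicit.
Unset Printing Implicit Defensive.

Record sgraph := SGraph {
  vertex :> finType;
  adj : rel vertex;
  adj_sym : symmetric adj;
  adj_irrefl : irreflexive adj
}.

Definition nbhd (G : sgraph) (v : G) : {set G} := [set u | adj v u].

Definition dominating (G : sgraph) (S : {set G}) : bool :=
  [forall u in ~: S, exists v in S, adj u v].

Definition super_dominating (G : sgraph) (S : {set G}) : bool :=
  dominating S &&
  [forall u in ~: S, exists v in S, nbhd v :&: ~: S == [set u]].

(* [partition] already forces the parts to be nonempty. *)
Definition super_coalition_partition (G : sgraph) (P : {set {set G}}) : bool :=
  [&& partition P [set: G],
      [forall A in P, ~~ super_dominating A]
    & [forall A in P, exists B in P,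
         (B != A) && super_dominating (A :|: B)]].

(* The maximum over an empty range is 0, which is the convention for graphs
   without a super coalition partition. *)
Definition super_coalition_number (G : sgraph) : nat :=
  \max_(P : {set {set G}} | super_coalition_partition P) #|P|.

(* Main.v *)
(** If [z] is an isolated vertex, every super dominating set contains [z], so in
    a super coalition partition every part [A] forms a coalition with the part
    [A0] containing [z].  As [A0] is not super dominating, some vertex [u]
    outside [A0] has no private neighbor in [A0]; but it has one in [A :|: A0]
    for each part [A] other than [A0] and the part of [u], and these are pairwise
    distinct.  Hence there are at most [deg u + 2] parts.

    The bound is attained with maximum degree [n] by an edge plus an isolated
    vertex ([n = 1]), and by the subdivision of the complete graph on [n + 1]
    vertices plus isolated vertices ([n > 1]): the parts are the singletons of
    the original vertices, and the set of all the other vertices. *)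
Require Import Defs.
From mathcomp Require Import all_boot.

Set Implicit Arguments.
Unset Strict Implicit.
Unset Printing Implicit Defensive.

Definition private_nbr (G : sgraph) (S : {set G}) (u v : G) : bool :=
  nbhd v :&: ~: S == [set u].

Lemma private_nbr_adj (G : sgraph) (S : {set G}) (u v : G) :
  private_nbr S u v -> adj v u.
Proof. by move=> /eqP/setP/(_ u); rewrite !inE eqxx => /andP[]. Qed.

(** A private neighbor of [u] is in particular adjacent to [u], which yields domination. *)
Lemma super_dominatingP (G : sgraph) (S : {set G}) :
  reflect (forall u, u \notin S -> exists2 v, v \in S & private_nbr S u v)
          (super_dominating S).
Proof.
apply: (iffP andP) => [[_ /forall_inP H] u uS | H].
  by have /exists_inP := H u (etrans (in_setC _ _) uS).
split; apply/forall_inP => u; rewrite in_setC => /H[v vS uv]; apply/exists_inP;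
  exists v => //.
by rewrite adj_sym (private_nbr_adj uv).
Qed.

Section Isolated.

Variables (G : sgraph) (z : G).
Hypothesis z_isolated : forall v, ~~ adj v z.

Lemma isolated_in_super_dominating (S : {set G}) : super_dominating S -> z \in S.
Proof.
move=> /super_dominatingP H; apply: contraT => /H[v _ /private_nbr_adj].
by rewrite (negPf (z_isolated v)).
Qed.

Lemma super_coalition_partition_bound (d : nat) (P : {set {set G}}) :
  (forall v : G, #|nbhd v| <= d) -> super_coalition_partition P -> #|P| <= d + 2.
Proof.
move=> deg_le /and3P[/and3P[/eqP covP trivP _] /forall_inP nsup /forall_inP coal].
have in_cov x : x \in cover P by rewrite covP inE.
pose A0 := pblock P z.
have A0P : A0 \in P by rewrite pblock_mem.
have coalA0 A : A \in P -> A != A0 -> super_dominating (A :|: A0).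
  move=> AP AA0; have /exists_inP[B BP /andP[_ sAB]] := coal _ AP.
  have := isolated_in_super_dominating sAB; rewrite inE.
  case/orP=> zin; first by rewrite /A0 (def_pblock trivP AP zin) eqxx in AA0.
  by rewrite /A0 (def_pblock trivP BP zin).
have [u uA0 npriv] : exists2 u, u \notin A0 &
    forall v, v \in A0 -> ~~ private_nbr A0 u v.
  have := nsup _ A0P.
  case: (boolP [exists u in ~: A0, [forall v in A0, ~~ private_nbr A0 u v]]).
    case/exists_inP=> u; rewrite inE => uA0 /forall_inP npriv _.
    by exists u.
  move=> /exists_inPn H /super_dominatingP[] u uA0.
  have := H u; rewrite inE => /(_ uA0) /forall_inPn[v vA0 /negPn uv].
  by exists v.
(* The part of [u] is removed because its union with [A0] contains [u] and so provides no private
   neighbor for it. On [Q] the default [z] of [f] is never taken. *)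
pose Q := P :\ A0 :\ pblock P u.
pose f (A : {set G}) :=
  odflt z [pick v | (v \in A :|: A0) && private_nbr (A :|: A0) u v].
have fP A : A \in Q -> f A \in A :|: A0 /\ private_nbr (A :|: A0) u (f A).
  case/setD1P => Au /setD1P[AA0 AP].
  have uAA0 : u \notin A :|: A0.
    rewrite inE negb_or uA0 andbT; apply: contra Au => uA.
    by rewrite (def_pblock trivP AP uA).
  have /super_dominatingP/(_ _ uAA0)[v vA uv] := coalA0 _ AP AA0.
  rewrite /f; case: pickP => [w /andP //|/(_ v)/negP[]].
  exact/andP.
have f_inj : {in Q &, injective f}.
  move=> A B AQ BQ fAB; apply/eqP; apply: contraT => AB.
  have [fA uA] := fP _ AQ; have [] := fP _ BQ; rewrite -fAB => fB uB.
  have AP : A \in P by move: AQ; rewrite !inE => /and3P[].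
  have BP : B \in P by move: BQ; rewrite !inE => /and3P[].
  have /pred0P dis := trivIsetP trivP _ _ AP BP AB.
  have fA0 : f A \in A0.
    case/setUP: fA => // fA; case/setUP: fB => // fB.
    by have := dis (f A); rewrite /= fA fB.
  (* As [A] and [B] are disjoint, the complement of [A0] is the union of those of [A :|: A0] and
     [B :|: A0]; the neighborhood of [f A] meets each of them exactly in [u]. *)
  suff: private_nbr A0 u (f A) by rewrite (negPf (npriv _ fA0)).
  apply/eqP/setP => w; move: (dis w) => /=.
  move: uA uB => /eqP/setP/(_ w) + /eqP/setP/(_ w); rewrite !inE.
  by case: (w \in A); case: (w \in B); case: (w \in A0); rewrite ?andbT ?andbF.
have cardQ : #|Q| <= d.
  apply: leq_trans (deg_le u); rewrite -(card_in_imset f_inj).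
  apply/subset_leq_card/subsetP => _ /imsetP[A AQ ->].
  by have [_ /private_nbr_adj] := fP _ AQ; rewrite inE adj_sym.
have cardP : #|P| <= #|Q| + 2.
  rewrite (cardsD1 A0 P) (cardsD1 (pblock P u) (P :\ A0)) addnA addnC leq_add2l.
  by rewrite -[2]/(1 + 1) leq_add ?leq_b1.
by apply: leq_trans cardP _; rewrite leq_add2r.
Qed.

Lemma singletons_super_coalition_partition (X : {set G}) :
  z \notin X -> ~~ super_dominating (~: X) ->
  {in X, forall x, super_dominating (x |: ~: X)} ->
  super_coalition_partition (~: X |: [set [set x] | x in X]).
Proof.
move=> zX nX sX; apply/and3P; split; first (apply/and3P; split).
- apply/eqP/setP => y; rewrite [RHS]inE; apply/bigcupP.
  case: (boolP (y \in X)) => yX.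
    by exists [set y]; rewrite !inE ?eqxx // imset_f ?orbT.
  by exists (~: X); rewrite !inE ?eqxx.
- apply/trivIsetP => A B /setU1P[->|/imsetP[x xX ->]] /setU1P[->|/imsetP[y yX ->]].
  + by rewrite eqxx.
  + by rewrite disjoint_sym disjoints1 inE negbK yX.
  + by rewrite disjoints1 inE negbK xX.
  + by rewrite disjoints1 inE; apply: contraNN => /eqP ->.
- rewrite !inE negb_or; apply/andP; split.
    by apply/eqP => /setP/(_ z); rewrite !inE zX.
  by apply/imsetP => -[x _ /setP/(_ x)]; rewrite !inE eqxx.
- apply/forall_inP => A /setU1P[-> //|/imsetP[x xX ->]].
  apply/negP => /isolated_in_super_dominating; rewrite inE => /eqP zx.
  by rewrite zx xX in zX.
have neq x : x \in X -> [set x] != ~: X.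
  by move=> xX; apply/eqP => /setP/(_ x); rewrite !inE eqxx xX.
apply/forall_inP => A /setU1P[->|/imsetP[x xX ->]]; apply/exists_inP.
  (* The part [~: X] needs a singleton as partner. If [X] were empty, [~: X] would be the whole
     vertex set, which is super dominating. *)
  have [X0|[x xX]] := set_0Vmem X.
    case/super_dominatingP: nX => u.
    by rewrite X0 setC0 inE.
  exists [set x]; first by rewrite !inE imset_f ?orbT.
  by rewrite neq // setUC sX.
by exists (~: X); rewrite ?setU11 // eq_sym neq // sX.
Qed.

(** The [d.+1] singletons together with [~: X], which contains [z], meet the upper bound. *)
Lemma super_coalition_number_isolated (d : nat) (X : {set G}) :
  (forall v : G, #|nbhd v| <= d) -> #|X| = d.+1 ->
  z \notin X -> ~~ super_dominating (~: X) ->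
  {in X, forall x, super_dominating (x |: ~: X)} ->
  super_coalition_number G = d + 2.
Proof.
move=> deg_le cardX zX nX sX; apply/eqP; rewrite eqn_leq; apply/andP; split.
  by apply/bigmax_leqP => P; apply: super_coalition_partition_bound.
have scp := singletons_super_coalition_partition zX nX sX.
apply: leq_trans (leq_bigmax_cond (F := fun P : {set {set G}} => #|P|) _ scp).
rewrite cardsU1 card_imset ?cardX; last exact: set1_inj.
suff -> : ~: X \notin [set [set x] | x in X] by rewrite addnC.
by apply/imsetP => -[x xX /setP/(_ x)]; rewrite !inE eqxx xX.
Qed.

End Isolated.

Definition edge_point_adj (x y : option bool) : bool :=
  [&& x != None, y != None & x != y].

Lemma edge_point_sym : symmetric edge_point_adj.
Proof. by do 2 case=> [[]|]. Qed.

Lemma edge_point_irrefl : irreflexive edge_point_adj.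
Proof. by case=> [[]|]. Qed.

Definition edge_point := SGraph edge_point_sym edge_point_irrefl.

Lemma super_coalition_number_edge_point : super_coalition_number edge_point = 3.
Proof.
pose X : {set edge_point} := ~: [set None].
apply: (@super_coalition_number_isolated edge_point None _ 1 X).
- by case=> [[]|].
- move=> v; suff /subset_leq_card : nbhd v \subset [set omap negb v].
    by rewrite cards1.
  by apply/subsetP => w; rewrite !inE; case: v w => [[]|] [[]|].
- by have := cardsC1 (None : edge_point); rewrite card_option card_bool.
- by rewrite !inE.
- rewrite setCK; apply/super_dominatingP => /(_ (Some true)).
  rewrite inE => /(_ isT)[v]; rewrite inE => /eqP-> /private_nbr_adj.
  by [].
- move=> x; rewrite !inE setCK => xN; apply/super_dominatingP => u uS.
  exists x; first by rewrite setU11.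
  apply/eqP/setP => w; move: xN uS; rewrite !inE.
  by case: x u w => [[]|] [[]|] [[]|].
Qed.

(** The 1-subsets of ['I_m] are the original vertices and the 2-subsets the
    subdivision vertices; all other subsets are isolated. *)
Definition subdiv_adj (m : nat) (A B : {set 'I_m}) : bool :=
  [&& #|A| == 1, #|B| == 2 & A \subset B] || [&& #|B| == 1, #|A| == 2 & B \subset A].

Lemma subdiv_sym (m : nat) : symmetric (@subdiv_adj m).
Proof. by move=> A B; rewrite /subdiv_adj orbC. Qed.

Lemma subdiv_irrefl (m : nat) : irreflexive (@subdiv_adj m).
Proof. by move=> A; rewrite /subdiv_adj orbb; case: eqP => // ->. Qed.

Definition subdiv (m : nat) := SGraph (@subdiv_sym m) (@subdiv_irrefl m).

(** An original vertex [[set i]] has only neighbors [[set i; j]] with [j != i]; a subdivision vertex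
    has at most its two endpoints, whence [1 < m]. *)
Lemma subdiv_degree (m : nat) (A : subdiv m.+1) : 1 < m -> #|nbhd A| <= m.
Proof.
move=> m_gt1; have [A1|nA1] := boolP (#|A| == 1).
  have /cards1P[i Ai] := A1.
  suff /subset_leq_card : nbhd A \subset [set [set i; j] | j in [set~ i]].
    by move=> /leq_trans; apply; rewrite (leq_trans (leq_imset_card _ _)) // cardsC1 card_ord.
  apply/subsetP => B; rewrite inE /= /subdiv_adj A1 /=.
  case/orP => [/andP[/cards2P[j [k [jk ->]]]]|/and3P[_ ]]; last by rewrite (eqP A1).
  rewrite Ai sub1set !inE => /orP[]/eqP ij; subst i.
    by apply: imset_f; rewrite !inE eq_sym.
  by rewrite setUC; apply: imset_f; rewrite !inE.
apply: leq_trans m_gt1.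
have [A2|nA2] := boolP (#|A| == 2).
  rewrite -[leqRHS](eqP A2) -(card_imset (mem A) set1_inj).
  apply/subset_leq_card/subsetP => B; rewrite inE /= /subdiv_adj (negPf nA1) /=.
  case/and3P => /cards1P[i ->] _; rewrite sub1set => iA.
  exact: imset_f.
suff -> : nbhd A = set0 by rewrite cards0.
by apply/setP => B; rewrite !inE /= /subdiv_adj (negPf nA1) (negPf nA2) /= andbF.
Qed.

Lemma super_coalition_number_subdiv (n : nat) :
  1 < n -> super_coalition_number (subdiv n.+1) = n + 2.
Proof.
move=> n_gt1; pose X : {set subdiv n.+1} := [set [set i] | i in 'I_n.+1].
have inX (B : {set 'I_n.+1}) : (B \in X) = (#|B| == 1).
  apply/imsetP/cards1P => [[i _ ->]|[i ->]]; by exists i.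
apply: (@super_coalition_number_isolated (subdiv n.+1) set0 _ n X).
- move=> v; rewrite /= /subdiv_adj cards0 /= andbF /=.
  by case: #|v| => [|[|]].
- by move=> v; apply: subdiv_degree.
- by rewrite card_imset ?card_ord //; apply: set1_inj.
- by rewrite inX cards0.
- apply/super_dominatingP => /(_ [set ord0]).
  rewrite inE inX cards1 => /(_ isT)[B]; rewrite inE inX => nB1 uB.
  have := private_nbr_adj uB; rewrite /= /subdiv_adj (negPf nB1) /=.
  case/and3P=> _ /cards2P[i [j [ij BE]]] _.
  (* Both endpoints of the subdivision vertex [B] lie in [X], so privacy would force each of them to
     be [ord0]. *)
  have in0 k : k \in B -> k = ord0.
    move=> kB; apply: set1_inj; apply/set1P; rewrite -(eqP uB) !inE inX cards1.
    by rewrite /= /subdiv_adj cards1 sub1set kB BE cards2 ij.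
  have i0 : i = ord0 by apply: in0; rewrite BE set21.
  have j0 : j = ord0 by apply: in0; rewrite BE set22.
  by rewrite i0 j0 eqxx in ij.
- move=> _ /imsetP[i _ ->]; apply/super_dominatingP => u.
  rewrite !inE negb_or negbK => /andP[ui]; rewrite inX => /cards1P[j uj].
  subst u; have ij : i != j by apply: contraNN ui => /eqP->.
  (* Of the two endpoints of this subdivision vertex, [[set i]] has joined the set, leaving only
     [[set j]] outside. *)
  exists [set i; j]; first by rewrite !inE inX cards2 ij orbT.
  apply/eqP/setP => B; rewrite !inE negb_or negbK inX /= /subdiv_adj cards2 ij /=.
  have [/cards1P[k ->]|nB1] := boolP (#|B| == 1).
    rewrite sub1set !inE andbT !(inj_eq set1_inj).
    by have [->|] := eqVneq k i; rewrite ?andbF ?(negPf ij) ?andbT.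
  by rewrite !andbF; apply/esym/negbTE; apply: contraNN nB1 => /eqP->; rewrite cards1.
Qed.

Theorem theorem6p1 (n : nat) (hn : 0 < n) :
  exists G : sgraph, super_coalition_number G = n + 2.
Proof.
(* The case [n = 1] is separate: the subdivision vertex of a single edge has degree 2, exceeding
   [n]. *)
case: n hn => [//|[_|n _]].
  by exists edge_point; apply: super_coalition_number_edge_point.
by exists (subdiv n.+3); apply: super_coalition_number_subdiv.
Qed.
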